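(* There is an absolute constant $C>0$ such that the following holds. Let $n$ be an odd positive integer, $G=\mathbb{Z}/n\mathbb{Z}$, $S\subset G^n$ the set of bijections $\{1,\dots,n\}\to G$, and let $1\le m\le n/2$ be an integer. Then \[ \sum_{m\text{-sparse }\chi}|\widehat{1_S}(\chi)|^2\le C\,m^{1/4}\,e^{C m^{3/2}/n^{1/2}}\binom{n}{m}^{1/2}\frac{n!^2}{n^{2n}}. \]
   Context: Characters of $G^n$ are identified with $n$-tuples $\chi=(r_1,\dots,r_n)\in(\frac1n\mathbb{Z}/\mathbb{Z})^n$, and \[ \widehat{1_S}(r_1,\dots,r_n)=\frac1{n^n}\sum_{\substack{x_1,\dots,x_n\in G\\ \text{distinct}}} e(-r_1x_1-\cdots-r_nx_n),\qquad e(x)=e^{2\pi i x}. \] A character $\chi$ is $m$-sparse if exactly $m$ of its coordinates are nonzero. *)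

(* Defs.v *)
(* MathComp and MathComp-Analysis, with R[i] (real-closed) as complex numbers
   over an arbitrary realType R. *)
From HB Require Import structures.
From mathcomp Require Import all_boot all_order all_algebra.
From mathcomp Require Import all_classical all_reals all_analysis.
From mathcomp Require Import complex.
Set Implicit Arguments.
Unset Strict Implicit.
Unset Printing Implicit Defensive.
Import Order.TTheory GRing.Theory Num.Theory.
Local Open Scope ring_scope.

(* e(t) = exp(2 pi i t). *)
Definition e (R : realType) (t : R) : R[i] :=
  Complex (cos (2 * pi * t)) (sin (2 * pi * t)).

(* G^n for G = Z/nZ.  MathComp's 'Z_n is Z/nZ only when 1 < n. *)
Definition Gn (n : nat) := {ffun 'I_n -> 'Z_n}.

(* A coordinate r_i in (1/n)Z/Z is stored as its numerator a_i in Z/nZ, that is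
   r_i = a_i / n, so that (r_1, ..., r_n) is also encoded by an element of
   {ffun 'I_n -> 'Z_n}, and r_i = 0 iff a_i = 0. *)
Definition charn (n : nat) := {ffun 'I_n -> 'Z_n}.

(* r_1 x_1 + ... + r_n x_n, computed on representatives in {0, ..., n-1}; a
   change of representatives alters it by an integer, which e does not see. *)
Definition pairing (R : realType) (n : nat) (chi : charn n) (x : Gn n) : R :=
  \sum_(i < n) (chi i : nat)%:R / n%:R * (x i : nat)%:R.

Definition fourier (R : realType) (n : nat) (f : Gn n -> R[i]) (chi : charn n)
    : R[i] :=
  (n%:R ^+ n)^-1 * \sum_(x : Gn n) f x * e (- pairing R chi x).

Definition bijections (n : nat) : {set Gn n} :=
  [set x : Gn n | `[< bijective x >]].

Definition indicator (R : realType) (n : nat) (A : {set Gn n}) (x : Gn n)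
    : R[i] :=
  (x \in A)%:R.

Definition sparse (n m : nat) (chi : charn n) : bool :=
  #|[set i | chi i != 0]| == m.

(* Main.v *)
(* The square-summed Fourier mass E(A) of the characters with support exactly A
   is computed by inclusion-exclusion: by orthogonality the mass of the
   characters supported inside A is n^|A| / n^(2n) times the number of pairs of
   bijections agreeing on A, that is N g(|A|) with N = n!^2 / n^(2n) and
   g(k) = n^k (n-k)! / n!.  Hence E(A) = N D_|A| with D_j the j-th finite
   difference of g at 0.  From (n-k) (g(k+1) - g(k)) = k g(k) and Leibniz' rule,
   (n-j) D_(j+1) = j (2 D_j + D_(j-1)).  Setting a_j = D_j binom(n,j)^(1/2) this
   gives a_j <= a_(j-2) + 3 (m/n)^(1/2) a_(j-1) for j <= m <= n/2, so that
   a_m <= (1 + 3 (m/n)^(1/2))^m, while the sum in question is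
   N binom(n,m) D_m = N binom(n,m)^(1/2) a_m. *)
Require Import Defs.
From HB Require Import structures.
From mathcomp Require Import all_boot all_order all_algebra fingroup perm.
From mathcomp Require Import all_classical all_reals all_analysis.
From mathcomp Require Import complex ring lra zify.
Set Implicit Arguments.
Unset Strict Implicit.
Unset Printing Implicit Defensive.
Import Order.TTheory GRing.Theory Num.Theory.
Local Open Scope ring_scope.

(** * Forward differences and Newton's expansion *)

Definition fdiff (V : zmodType) (g : nat -> V) (k : nat) : V := g k.+1 - g k.

Lemma eq_iter_fdiff (V : zmodType) (f g : nat -> V) j k :
  f =1 g -> iter j (@fdiff V) f k = iter j (@fdiff V) g k.
Proof.
move=> fg; elim: j k => [|j IHj] k /=; first exact: fg.
by rewrite /fdiff !IHj.
Qed.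

(** Induction on [k] for all [g] at once: [g] and [fdiff g] are both expanded at [k], and Pascal's
    rule merges the two sums. *)
Lemma newton_series (V : zmodType) (g : nat -> V) k :
  g k = \sum_(j < k.+1) iter j (@fdiff V) g 0%N *+ 'C(k, j).
Proof.
elim: k g => [|k IHk] g; first by rewrite big_ord1 bin0.
have -> : g k.+1 = g k + fdiff g k by rewrite /fdiff addrC subrK.
rewrite (IHk g) (IHk (fdiff g)) big_ord_recl [RHS]big_ord_recl !bin0 -!addrA.
congr (_ + _).
(* The added top term vanishes because 'C(k, k+1) = 0; it makes the two sums equally long. *)
have -> : \sum_(i < k) iter (bump 0 i) (@fdiff V) g 0%N *+ 'C(k, bump 0 i) =
    \sum_(i < k.+1) iter i.+1 (@fdiff V) g 0%N *+ 'C(k, i.+1).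
  by rewrite big_ord_recr /= bin_small // mulr0n addr0.
rewrite -big_split; apply: eq_bigr => i _.
by rewrite binS mulrnDr iterSr.
Qed.

Lemma iter_fdiffB (V : zmodType) (f g : nat -> V) j k :
  iter j (@fdiff V) (fun i => f i - g i) k =
  iter j (@fdiff V) f k - iter j (@fdiff V) g k.
Proof.
elim: j k => [//|j IHj] k /=.
by rewrite /fdiff !IHj !opprD addrACA.
Qed.

Lemma iter_fdiff_eq0 (V : zmodType) (u : nat -> V) n j k :
  (forall i, (i < n)%N -> u i = 0) -> (k + j < n)%N ->
  iter j (@fdiff V) u k = 0.
Proof.
move=> u0; elim: j k => [|j IHj] k lt_n /=; first by rewrite u0 // -(addn0 k).
by rewrite /fdiff !IHj ?subrr //; lia.
Qed.

(** Leibniz' rule for differences: the identity has constant first difference, so only two terms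
    survive. *)
Lemma iter_fdiff_mul_id (R : comNzRingType) (h : nat -> R) j k :
  iter j.+1 (@fdiff R) (fun i => i%:R * h i) k =
  k%:R * iter j.+1 (@fdiff R) h k + j.+1%:R * iter j (@fdiff R) h k.+1.
Proof.
elim: j k => [|j IHj] k; first by rewrite /= /fdiff -natr1; ring.
by rewrite iterS {1}/fdiff !IHj /= /fdiff -!natr1; ring.
Qed.

Lemma iter_fdiff_mul_lin (R : comNzRingType) (a : R) (h : nat -> R) j :
  iter j.+1 (@fdiff R) (fun i => (a - i%:R) * h i) 0%N =
  a * iter j.+1 (@fdiff R) h 0%N - j.+1%:R * iter j (@fdiff R) h 1%N.
Proof.
have scal i k : iter i (@fdiff R) (fun i => a * h i) k = a * iter i (@fdiff R) h k.
  elim: i k => [//|i IHi] k /=; rewrite /fdiff !IHi; ring.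
rewrite (eq_iter_fdiff _ _ (g := fun i => a * h i - i%:R * h i)); last first.
  by move=> i; rewrite mulrBl.
by rewrite iter_fdiffB scal iter_fdiff_mul_id mul0r add0r.
Qed.

(** * The coefficients D_j: recurrence and growth *)

(** The g of the overview: n^k times the probability that a uniform permutation fixes k given
    points, for k <= n. *)
Definition partial_match (F : numFieldType) (n k : nat) : F :=
  n%:R ^+ k * (n - k)`!%:R / n`!%:R.

Lemma partial_match_rec (F : numFieldType) n k : (k < n)%N ->
  (n%:R - k%:R) * fdiff (partial_match F n) k = k%:R * partial_match F n k.
Proof.
move=> ltkn; rewrite /fdiff /partial_match.
have -> : (n - k)`! = ((n - k) * (n - k.+1)`!)%N.
  by have -> : (n - k = (n - k.+1).+1)%N by lia.
have n0 : n`!%:R != 0 :> F by rewrite pnatr_eq0 -lt0n fact_gt0.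
by rewrite natrM (natrB _ (ltnW ltkn)) exprS; field.
Qed.

Definition match_coef (F : numFieldType) (n j : nat) : F :=
  iter j (@fdiff F) (partial_match F n) 0%N.

Lemma match_coef0 (F : numFieldType) n : match_coef F n 0 = 1.
Proof.
by rewrite /match_coef /= /partial_match subn0 mul1r divff // pnatr_eq0 -lt0n fact_gt0.
Qed.

Lemma match_coef1 (F : numFieldType) n : (0 < n)%N -> match_coef F n 1 = 0.
Proof.
move=> n0; have := partial_match_rec F n0; rewrite subr0 mul0r => /eqP.
by rewrite mulf_eq0 pnatr_eq0 eqn0Ngt n0 => /eqP.
Qed.

(** The difference of order [j.+1] at 0 reads only the values at 0, ..., j+1. All of these lie below
    [n], where [partial_match_rec] holds. The j of the overview is [j.+1] here. *)
Lemma match_coef_rec (F : numFieldType) n j : (j.+1 < n)%N ->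
  (n%:R - j.+1%:R) * match_coef F n j.+2 =
  j.+1%:R * (2 * match_coef F n j.+1 + match_coef F n j).
Proof.
move=> ltjn; pose g := partial_match F n.
have : iter j.+1 (@fdiff F)
    (fun k => (n%:R - k%:R) * fdiff g k - k%:R * g k) 0%N = 0.
  apply: (@iter_fdiff_eq0 _ _ n) => // i ltin.
  by rewrite partial_match_rec // subrr.
rewrite iter_fdiffB iter_fdiff_mul_lin iter_fdiff_mul_id mul0r add0r.
have step i : iter i (@fdiff F) g 1%N = match_coef F n i.+1 + match_coef F n i.
  by rewrite {2}/match_coef /= /fdiff subrK.
rewrite -!iterSr !step -/(match_coef F n j.+2) => /eqP.
by rewrite subr_eq0 subr_eq => /eqP E; rewrite mulrBl E; ring.
Qed.

Lemma match_coef_ge0 (F : realFieldType) n j : (j <= n)%N -> 0 <= match_coef F n j.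
Proof.
elim/ltn_ind: j => -[|[|j]] IHj lejn; first by rewrite match_coef0.
  by rewrite match_coef1.
have : 0 <= (n%:R - j.+1%:R) * match_coef F n j.+2.
  rewrite match_coef_rec // mulr_ge0 // addr_ge0 ?mulr_ge0 ?IHj //; lia.
by rewrite pmulr_rge0 // subr_gt0 ltr_nat.
Qed.

Lemma match_coef_sqrt_bin_le (R : rcfType) (n m j : nat) :
  (2 * m <= n)%N -> (j <= m)%N ->
  match_coef R n j * Num.sqrt 'C(n, j)%:R <=
  (1 + 3 * Num.sqrt (m%:R / n%:R)) ^+ j.
Proof.
move=> le2mn; set s := Num.sqrt (m%:R / n%:R).
have s0 : 0 <= s by rewrite sqrtr_ge0.
elim/ltn_ind: j => -[|[|j]] IHj lejm.
- by rewrite match_coef0 bin0 sqrtr1 mulr1.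
- by rewrite match_coef1 ?mul0r ?exprn_ge0 ?addr_ge0 ?mulr_ge0 //; lia.
have n0 : 0 < n%:R :> R by rewrite ltr0n; lia.
pose N : R := n%:R - j.+1%:R.
have N0 : 0 < N by rewrite subr_gt0 ltr_nat; lia.
have D0 : 0 <= match_coef R n j by rewrite match_coef_ge0 //; lia.
have D1 : 0 <= match_coef R n j.+1 by rewrite match_coef_ge0 //; lia.
have B1 : j.+2%:R * 'C(n, j.+2)%:R = N * 'C(n, j.+1)%:R :> R.
  by rewrite -natrM mul_bin_left natrM natrB //; lia.
have B0 : j.+1%:R * 'C(n, j.+1)%:R = (N + 1) * 'C(n, j)%:R :> R.
  by rewrite -natrM mul_bin_left natrM natrB ?/N -?natr1; [congr (_ * _); ring | lia].
have le_n : 2 * m%:R <= n%:R :> R by rewrite -natrM ler_nat.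
have le_m : j.+2%:R <= m%:R :> R by rewrite ler_nat.
have j0 : 0 <= j%:R :> R by [].
have ej1 : j.+1%:R = j%:R + 1 :> R by rewrite natr1.
have ej2 : j.+2%:R = j%:R + 2 :> R by rewrite -natr1 ej1; ring.
pose b i : R := Num.sqrt 'C(n, i)%:R.
(* After squaring, [B1] reduces this to 4 n (j+1)^2 <= 9 (j+2) m N. Since n <= 2N and (j+1)^2 <=
   (j+2) m, even 8 would do for 9, hence the constant 3. *)
have first_le : 2 * j.+1%:R * b j.+2 <= N * (3 * s * b j.+1).
  rewrite -ler_sqr ?nnegrE ?mulr_ge0 ?sqrtr_ge0 ?(ltW N0) //.
  rewrite !exprMn !sqr_sqrtr ?divr_ge0 //.
  have P0 : 0 < j.+2%:R * n%:R :> R by rewrite mulr_gt0.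
  rewrite -(ler_pM2l P0).
  have -> : j.+2%:R * n%:R * (2 ^+ 2 * j.+1%:R ^+ 2 * 'C(n, j.+2)%:R) =
     4 * n%:R * j.+1%:R ^+ 2 * (j.+2%:R * 'C(n, j.+2)%:R) :> R by ring.
  have -> : j.+2%:R * n%:R * (N ^+ 2 * (3 ^+ 2 * (m%:R / n%:R) * 'C(n, j.+1)%:R)) =
     9 * j.+2%:R * m%:R * N * (N * 'C(n, j.+1)%:R) :> R by field; rewrite gt_eqF.
  rewrite B1 ler_wpM2r ?mulr_ge0 ?(ltW N0) //.
  have half : n%:R <= 2 * N by rewrite /N ej1; rewrite ej2 in le_m; lra.
  have sq : j.+1%:R ^+ 2 <= j.+2%:R * m%:R :> R.
    by move: le_m; rewrite ej1 ej2; nra.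
  have := ler_pM (ler0n R n) (sqr_ge0 j.+1%:R) half sq.
  have : 0 <= N * (j.+2%:R * m%:R) by rewrite !mulr_ge0 // ltW.
  lra.
(* After squaring, [B0] and [B1] reduce this to (N+1)(j+1) <= (j+2) N, that is j+1 <= N. *)
have second_le : j.+1%:R * b j.+2 <= N * b j.
  rewrite -ler_sqr ?nnegrE ?mulr_ge0 ?sqrtr_ge0 ?(ltW N0) //.
  rewrite !exprMn !sqr_sqrtr //.
  have P0 : 0 < j.+2%:R * (N + 1) :> R by rewrite mulr_gt0 // addr_gt0.
  rewrite -(ler_pM2l P0).
  have -> : j.+2%:R * (N + 1) * (j.+1%:R ^+ 2 * 'C(n, j.+2)%:R) =
     (N + 1) * j.+1%:R ^+ 2 * (j.+2%:R * 'C(n, j.+2)%:R) :> R by ring.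
  have -> : j.+2%:R * (N + 1) * (N ^+ 2 * 'C(n, j)%:R) =
     j.+2%:R * N ^+ 2 * ((N + 1) * 'C(n, j)%:R) :> R by ring.
  rewrite B1 -B0.
  have -> : (N + 1) * j.+1%:R ^+ 2 * (N * 'C(n, j.+1)%:R) =
    (N + 1) * j.+1%:R * (N * j.+1%:R * 'C(n, j.+1)%:R) :> R by ring.
  have -> : j.+2%:R * N ^+ 2 * (j.+1%:R * 'C(n, j.+1)%:R) =
    j.+2%:R * N * (N * j.+1%:R * 'C(n, j.+1)%:R) :> R by ring.
  rewrite ler_wpM2r ?mulr_ge0 ?(ltW N0) // ej1 ej2.
  have : N = n%:R - (j%:R + 1) by rewrite -ej1.
  rewrite ej2 in le_m; nra.
have IH0 : match_coef R n j * b j <= (1 + 3 * s) ^+ j by apply: IHj; lia.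
have IH1 : match_coef R n j.+1 * b j.+1 <= (1 + 3 * s) ^+ j.+1 by apply: IHj; lia.
have main : match_coef R n j.+2 * b j.+2 <=
    3 * s * (match_coef R n j.+1 * b j.+1) + match_coef R n j * b j.
  rewrite -(ler_pM2l N0) mulrA match_coef_rec; last by lia.
  have := ler_wpM2l D1 first_le; have := ler_wpM2l D0 second_le; lra.
(* With y = 1 + 3s >= 1, what remains is 1 + 3sy <= y + 3sy = y^2, times y^j. *)
apply: le_trans main _; rewrite !exprS in IH1 *.
have x0 : 0 <= (1 + 3 * s) ^+ j by rewrite exprn_ge0 // addr_ge0 // mulr_ge0.
set x := (1 + 3 * s) ^+ j in IH0 IH1 x0 *.
have : 3 * s * (match_coef R n j.+1 * b j.+1) <= 3 * s * ((1 + 3 * s) * x).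
  by rewrite ler_wpM2l // mulr_ge0.
nra.
Qed.

(** * The exponential [e] and orthogonality *)

Lemma e0 (R : realType) : e (0 : R) = 1.
Proof. by rewrite /e mulr0 cos0 sin0. Qed.

Lemma eD (R : realType) (s t : R) : e (s + t) = e s * e t.
Proof.
by rewrite /e mulrDr cosD sinD [X in Complex _ X]addrC.
Qed.

Lemma e_sum (R : realType) (I : finType) (F : I -> R) :
  e (\sum_i F i) = \prod_i e (F i).
Proof. exact: (big_morph _ (@eD R) (e0 R)). Qed.

Lemma eMn (R : realType) (t : R) k : e (t *+ k) = e t ^+ k.
Proof.
elim: k => [|k IHk]; first by rewrite e0 expr0.
by rewrite mulrS eD IHk exprS.
Qed.

Lemma e_nat (R : realType) k : e (k%:R : R) = 1.
Proof.
rewrite eMn /e mulr1 mulr_natl cos2pi sin2pi; exact: expr1n.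
Qed.

Lemma conj_e (R : realType) (t : R) : (e t)^* = e (- t).
Proof. by rewrite /e mulrN cosN sinN. Qed.

(** If e(t) = 1, then cos(2 pi t) = 1 forces sin(pi t) = 0, impossible for pi t strictly between 0
    and pi. *)
Lemma e_neq1 (R : realType) (t : R) : 0 < t < 1 -> e t != 1.
Proof.
case/andP=> t0 t1; rewrite eq_complex /= negb_and; apply/orP; left.
have pi0 := pi_gt0 R.
have s0 : 0 < sin (pi * t).
  by rewrite sin_gt0_pi // mulr_gt0 //= -[X in _ < X]mulr1 ltr_pM2l.
have -> : 2 * pi * t = (pi * t) *+ 2 by ring.
apply/eqP; rewrite cos_mulr2n => E.
have := cos2Dsin2 (pi * t); have := mulr_gt0 s0 s0; nra.
Qed.

Lemma sqr_normc (R : rcfType) (z : R[i]) :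
  ((ComplexField.Normc.normc z) ^+ 2)%:C%C = z * z^*.
Proof.
case: z => a b /=; rewrite sqr_sqrtr ?addr_ge0 ?sqr_ge0 //.
by apply/eqP; rewrite eq_complex /=; apply/andP; split; apply/eqP; ring.
Qed.

(** For distinct a and b this is a geometric sum whose ratio e((a-b)/n) is an n-th root of unity,
    different from 1 because 0 < |a-b| < n. *)
Lemma sum_e_orthogonal (R : realType) n (a b : 'I_n) :
  \sum_(c < n) e (c%:R / n%:R * (a%:R - b%:R) : R) = (a == b)%:R * n%:R.
Proof.
have n0 : n%:R != 0 :> R by rewrite pnatr_eq0; case: n a {b} => [[]|].
have [->|neq_ab] := eqVneq a b.
  rewrite (eq_bigr (fun=> 1)) => [|c _]; last by rewrite subrr mulr0 e0.
  by rewrite sumr_const card_ord mul1r.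
rewrite mul0r; set t : R := (a%:R - b%:R) / n%:R.
have -> : \sum_(c < n) e (c%:R / n%:R * (a%:R - b%:R) : R) = \sum_(c < n) e t ^+ c.
  by apply: eq_bigr => c _; rewrite -eMn /t; congr e; rewrite -mulr_natl; ring.
apply/eqP; have := subrX1 (e t) n.
have -> : e t ^+ n = 1.
  rewrite -eMn /t -[_ *+ n]mulr_natr divfK // eD e_nat mul1r -conj_e e_nat; exact: rmorph1.
rewrite subrr => /esym/eqP; rewrite mulf_eq0 subr_eq0 => /orP[|//].
suff /negPf-> : e t != 1 by [].
have n_gt0 : 0 < n%:R :> R by rewrite lt0r n0 ler0n.
have [ltba|ltab|eqab] := ltngtP b a; last by rewrite (val_inj eqab) eqxx in neq_ab.
  apply: e_neq1; rewrite divr_gt0 ?subr_gt0 ?ltr_nat //=.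
  by rewrite ltr_pdivrMr // mul1r ltrBlDr -natrD ltr_nat ltn_addr.
have : e (- t) != 1.
  apply: e_neq1; rewrite /t -mulNr opprB divr_gt0 ?subr_gt0 ?ltr_nat //=.
  by rewrite ltr_pdivrMr // mul1r ltrBlDr -natrD ltr_nat ltn_addr.
apply: contra_neq => et1; have := eD (- t) t.
by rewrite addNr e0 et1 mulr1.
Qed.

(** * Fourier mass of the bijections by support *)

(* For n = p.+2 the types 'Z_n and 'I_n are convertible, so a bijection in
   [Gn n] is a permutation of 'I_n. *)
Lemma sum_bijections (V : nmodType) p (F : Gn p.+2 -> V) :
  \sum_(x in bijections p.+2) F x = \sum_(s : {perm 'I_p.+2}) F (finfun s).
Proof.
transitivity (\sum_(x : {ffun 'I_p.+2 -> 'I_p.+2} | injectiveb x) F x).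
  apply: eq_bigl => x; rewrite inE.
  by apply/asboolP/injectiveP => [/bij_inj//|x_inj]; exact: injF_bij.
rewrite (reindex_onto (fun s : {perm 'I_p.+2} => finfun s)
  (fun x => if insub x is Some s then s else 1%g)) /= => [|x x_inj].
  apply: eq_bigl => s.
  have -> : finfun s = pval s by apply/ffunP => i; rewrite ffunE pvalE.
  by rewrite valK eqxx andbT; case: s.
by apply/ffunP => i; rewrite ffunE insubT -pvalE.
Qed.

(** Right multiplication by [s] carries the permutations fixing [A] pointwise onto those agreeing
    with [s] on [A]. *)
Lemma count_perm_agree n (A : {set 'I_n}) (s : {perm 'I_n}) :
  #|[set t : {perm 'I_n} | [forall i in A, t i == s i]]| = (n - #|A|)`!.
Proof.
have -> : (n - #|A|)%N = #|~: A| by rewrite [RHS]cardsCs finset.setCK card_ord.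
rewrite -card_perm -[RHS](card_imset _ (mulIg s)); apply: eq_card => t; rewrite inE.
apply/'forall_implyP/imsetP => [ts|[u + -> i iA]].
  exists (t * s^-1)%g; last by rewrite mulgKV.
  apply/fintype.subsetP => i; rewrite !inE permM; apply: contra => iA.
  by rewrite (eqP (ts i iA)) permK.
rewrite unfold_in permM => /fintype.subsetP/(_ i); rewrite !inE iA => /implyP.
by rewrite implybF negbK => /eqP->.
Qed.

Definition char_support (n : nat) (chi : charn n) : {set 'I_n} := [set i | chi i != 0].

Lemma fourier_bijections (R : realType) p (chi : charn p.+2) :
  fourier (indicator R (bijections p.+2)) chi =
  (p.+2%:R ^+ p.+2)^-1 *
  \sum_(s : {perm 'I_p.+2}) \prod_i e (- ((chi i : nat)%:R / p.+2%:R * (s i)%:R)).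
Proof.
rewrite /fourier; congr (_ * _).
under eq_bigr do rewrite /indicator mulr_natl mulrb.
rewrite -big_mkcond sum_bijections; apply: eq_bigr => s _.
rewrite /pairing -sumrN e_sum; apply: eq_bigr => i _.
by rewrite ffunE.
Qed.

Lemma sqr_normc_fourier (R : realType) p (chi : charn p.+2) :
  (ComplexField.Normc.normc (fourier (indicator R (bijections p.+2)) chi) ^+ 2)%:C%C =
  (p.+2%:R ^+ (2 * p.+2))^-1 *
  \sum_(s : {perm 'I_p.+2}) \sum_(t : {perm 'I_p.+2})
    \prod_i e ((chi i : nat)%:R / p.+2%:R * ((t i)%:R - (s i)%:R)).
Proof.
rewrite sqr_normc fourier_bijections rmorphM fmorphV rmorphXn rmorph_nat rmorph_sum.
rewrite mulrACA -invfM -exprD addnn mul2n; congr (_ * _).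
rewrite mulr_suml; apply: eq_bigr => s _.
rewrite mulr_sumr; apply: eq_bigr => t _.
rewrite rmorph_prod -big_split; apply: eq_bigr => i _.
by rewrite /= conj_e -eD opprK mulrBr addrC.
Qed.

(** The coordinates of such a character are free on [A] and zero elsewhere, so the sum factors over
    i: orthogonality applies on [A], and every other factor is 1. *)
Lemma sum_supported_agree (R : realType) p (A : {set 'I_p.+2}) (s t : {perm 'I_p.+2}) :
  \sum_(chi : charn p.+2 | char_support chi \subset A)
    \prod_i e ((chi i : nat)%:R / p.+2%:R * ((t i)%:R - (s i)%:R) : R) =
  [forall i in A, t i == s i]%:R * p.+2%:R ^+ #|A|.
Proof.
pose Q i : pred 'I_p.+2 := fun c => (i \in A) || (c == 0).
rewrite (eq_bigl (fun chi : charn p.+2 => chi \in family Q)) => [|chi]; last first.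
  apply/fintype.subsetP/familyP => [sA i|sQ i].
    rewrite unfold_in /Q; have := sA i; rewrite inE.
    by case: eqP => _; [rewrite orbT | move=> ->].
  by rewrite inE; have := sQ i; rewrite unfold_in => /orP[//|->].
rewrite -(bigA_distr_big_dep Q
  (fun i c => e ((c : nat)%:R / p.+2%:R * ((t i)%:R - (s i)%:R) : R))).
rewrite (bigID (mem A)) /= [X in _ * X]big1 => [|i /negPf iA]; last first.
  by rewrite /Q iA big_pred1_eq mul0r mul0r e0.
rewrite mulr1 (eq_bigr (fun i => (t i == s i)%:R * p.+2%:R)) => [|i iA]; last first.
  by rewrite -sum_e_orthogonal; apply: eq_bigl => c; rewrite /Q iA.
rewrite big_split prodr_const; congr (_ * _).
case: (boolP [forall i in A, t i == s i]) => [/'forall_implyP ts|].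
  by rewrite big1 // => i iA; rewrite ts.
case/forallPn => i; rewrite negb_imply => /andP[iA /negPf ts].
by rewrite (bigD1 i) //= ts mul0r.
Qed.

Definition energy (R : realType) n (chi : charn n) : R :=
  ComplexField.Normc.normc (fourier (indicator R (bijections n)) chi) ^+ 2.

(** Each of the n! permutations s has (n-|A|)! partners t agreeing with it on [A], and each such
    pair contributes n^|A|. *)
Lemma sum_supported_energy (R : realType) p (A : {set 'I_p.+2}) :
  \sum_(chi : charn p.+2 | char_support chi \subset A) energy R chi =
  p.+2%:R ^+ #|A| * (p.+2 - #|A|)`!%:R * p.+2`!%:R / p.+2%:R ^+ (2 * p.+2).
Proof.
apply: (@complexI R); rewrite rmorph_sum /=.
under eq_bigr do rewrite sqr_normc_fourier.
rewrite -mulr_sumr exchange_big /=.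
have inner (s : {perm 'I_p.+2}) :
  \sum_(chi : charn p.+2 | char_support chi \subset A) \sum_(t : {perm 'I_p.+2})
    \prod_i e ((chi i : nat)%:R / p.+2%:R * ((t i)%:R - (s i)%:R) : R) =
  (p.+2 - #|A|)`!%:R * p.+2%:R ^+ #|A|.
  rewrite exchange_big /=; under eq_bigr do rewrite sum_supported_agree.
  rewrite -mulr_suml -natr_sum -(count_perm_agree A s).
  by rewrite -sum1dep_card [in RHS]big_mkcond.
under eq_bigr do rewrite inner.
rewrite sumr_const card_Sn.
rewrite !rmorphM fmorphV !rmorphXn !rmorph_nat -[_ *+ _`!]mulr_natr; ring.
Qed.

(** Uniqueness in Moebius inversion, by induction on [#|A|]: the terms of proper subsets cancel. It
    stands in for an explicit inclusion-exclusion formula. *)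
Lemma eq_sum_subsets (V : zmodType) (T : finType) (f h : {set T} -> V) :
  (forall A : {set T}, \sum_(B : {set T} | B \subset A) f B =
             \sum_(B : {set T} | B \subset A) h B) -> f =1 h.
Proof.
move=> fh A; have [k] := ubnP #|A|; elim: k A => // k IHk A; rewrite ltnS => leAk.
have := fh A; rewrite (bigD1 A) //= [RHS](bigD1 A) //=.
rewrite (eq_bigr h) => [/addIr//|B /andP[BA neqBA]].
by apply: IHk; rewrite (leq_trans _ leAk) // proper_card // finset.properEneq neqBA.
Qed.

Lemma sum_subsets_card (V : nmodType) (T : finType) (A : {set T}) (h : nat -> V) :
  \sum_(B : {set T} | B \subset A) h #|B| =
  \sum_(j < #|A|.+1) h j *+ 'C(#|A|, j).
Proof.
rewrite (partition_big (fun B : {set T} => inord #|B| : 'I_#|A|.+1) predT) //=.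
apply: eq_bigr => j _; rewrite -cards_draws -sumr_const.
rewrite (eq_bigr (fun=> h j)) => [|B /andP[BA /eqP<-]].
  apply: eq_bigl => B; rewrite !inE; case: (boolP (B \subset A)) => //= BA.
  by rewrite -val_eqE /= inordK // ltnS subset_leq_card.
by rewrite inordK // ltnS subset_leq_card.
Qed.

(** Both sides have the same sums over subsets of [A]: on the right, Newton's expansion turns the
    sum of D_|B| into g(|A|). *)
Lemma energy_of_support (R : realType) p (A : {set 'I_p.+2}) :
  \sum_(chi : charn p.+2 | char_support chi == A) energy R chi =
  p.+2`!%:R ^+ 2 / p.+2%:R ^+ (2 * p.+2) * match_coef R p.+2 #|A|.
Proof.
move: A; apply: eq_sum_subsets => A.
rewrite -mulr_sumr (sum_subsets_card _ (match_coef R p.+2)) -newton_series.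
transitivity (\sum_(chi : charn p.+2 | char_support chi \subset A) energy R chi).
  rewrite [RHS](partition_big (@char_support p.+2) (fun B => B \subset A)) //=.
  apply: eq_bigr => B BA; apply: eq_bigl => chi.
  by case: eqP => [->|]; rewrite ?BA ?andbF.
rewrite sum_supported_energy /partial_match.
have n0 : p.+2`!%:R != 0 :> R by rewrite pnatr_eq0 -lt0n fact_gt0.
have d0 : p.+2%:R ^+ (2 * p.+2) != 0 :> R by rewrite expf_neq0.
by field; rewrite d0 n0.
Qed.

Lemma energy_sparse (R : realType) p m :
  \sum_(chi : charn p.+2 | sparse m chi) energy R chi =
  'C(p.+2, m)%:R * match_coef R p.+2 m *
    (p.+2`!%:R ^+ 2 / p.+2%:R ^+ (2 * p.+2)).
Proof.
rewrite (partition_big (@char_support p.+2) (fun A => #|A| == m)) //=.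
rewrite (eq_bigr (fun=> p.+2`!%:R ^+ 2 / p.+2%:R ^+ (2 * p.+2) *
    match_coef R p.+2 m)) => [|A /eqP <-].
  by rewrite sumr_const -[X in 'C(X, m)]card_ord -card_draws cardsE -[_ *+ #|_|]mulr_natr; ring.
rewrite -energy_of_support; apply: eq_bigl => chi.
rewrite /sparse -/(char_support chi).
by case: (_ =P A) => [->|_]; rewrite ?eqxx ?andbF.
Qed.

(** * From the coefficient bound to the sparse sum *)

Theorem theorem5p1 (R : realType) :
  exists C : R, 0 < C /\
  forall n m : nat, (0 < n)%N -> odd n -> (1 <= m)%N -> (2 * m <= n)%N ->
    \sum_(chi : charn n | sparse m chi)
       ComplexField.Normc.normc (fourier (indicator R (bijections n)) chi) ^+ 2
    <= C * m%:R `^ (1 / 4)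
         * expR (C * m%:R `^ (3 / 2) / n%:R `^ (1 / 2))
         * 'C(n, m)%:R `^ (1 / 2)
         * (n`!%:R ^+ 2 / n%:R ^+ (2 * n)).
Proof.
(* The 3 is that of (1 + 3s)^m <= exp(3ms), where ms = m^(3/2) / n^(1/2); the prefactor 3 m^(1/4) is
   at least 1. *)
exists 3; split=> // n m n0 n_odd m1 le2mn.
(* n = 1 contradicts 1 <= m <= n/2, so [n] is at least 2 and ['Z_n] is Z/nZ. *)
case: n => [|[|p]] // in n0 n_odd le2mn *; first by lia.
have := energy_sparse R p m; rewrite /energy => ->.
set n := p.+2 in le2mn *.
have m_ge1 : 1 <= m%:R :> R by rewrite ler1n.
have nR0 : 0 < n%:R :> R by [].
pose s : R := Num.sqrt (m%:R / n%:R).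
have half : 1 / 2 = 2^-1 :> R by rewrite mul1r.
rewrite ler_wpM2r ?divr_ge0 ?exprn_ge0 // half !powR12_sqrt //.
rewrite -(mulrA 3 (m%:R `^ (3 / 2))).
have -> : m%:R `^ (3 / 2) / Num.sqrt n%:R = m%:R * s :> R.
  have -> : 3 / 2 = 1 + 2^-1 :> R by field.
  rewrite powRD; last by apply/implyP => _; rewrite pnatr_eq0 -lt0n.
  by rewrite powRr1 // powR12_sqrt // /s sqrtrM // sqrtrV // mulrA.
have m14 : 1 <= m%:R `^ (1 / 4) :> R.
  by rewrite -[leLHS](powRr0 m%:R) ler_powR.
have a_le : match_coef R n m * Num.sqrt 'C(n, m)%:R <= expR (3 * (m%:R * s)).
  apply: le_trans (match_coef_sqrt_bin_le R le2mn (leqnn m)) _.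
  rewrite mulrCA expRM_natl lerXn2r ?nnegrE ?expR_ge0 ?expR_ge1Dx //.
(* One square root of the binomial is absorbed into a_m; the other matches the factor on the
   right. *)
rewrite -[X in X * match_coef _ _ _]sqr_sqrtr // expr2 mulrAC ler_wpM2r ?sqrtr_ge0 //.
rewrite mulrC; apply: le_trans a_le _.
by rewrite ler_peMl ?expR_ge0 // mulr_ege1 // ler1n.
Qed.
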